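(* Let $\mu$ be a Borel probability measure on $\mathbb{R}$ and let $\epsilon>0$. Then $$\limsup_{n\to\infty} n\, d_{\epsilon}(\mu,\delta_{\bullet}^{u_n}) = \max\left\{\left\|\,\Omega\!\left(\epsilon\,\frac{\mathrm{d}(\mu^{-1})_{\sf A}}{\mathrm{d}\lambda}\right)\right\|_{\infty},\ \sup_{x\in G_{(\mu^{-1})_{\sf S}}}\Omega(\iota(x))\right\}.$$
   Context: $\mathbb{R}^+$ denotes the positive reals, $\mathbb{N}_0=\{0,1,2,\ldots\}$, and $\lambda$ is Lebesgue measure on $\mathbb{R}$. For a Borel probability measure $\mu$ on $\mathbb{R}$ let $F_\mu(x)=\mu((-\infty,x])$ and $F_{\mu-}(x)=\mu((-\infty,x))$. For $\epsilon>0$ the $\epsilon$-Lévy metric is $$d_\epsilon(\mu,\nu)=\inf\{y\in\mathbb{R}^+ : F_{\mu-}(x-y/\epsilon)-y\le F_\nu(x)\le F_\mu(x+y/\epsilon)+y \text{ for all } x\in\mathbb{R}\}.$$ Best uniform approximation: for $n\in\mathbb{N}=\{1,2,\ldots\}$ let $\Xi_n=\{x\in\mathbb{R}^n: x_{,1}\le\ldots\le x_{,n}\}$ and, for $x\in\Xi_n$, $\delta_x^{u_n}=\frac1n\sum_{j=1}^n\delta_{x_{,j}}$, where $\delta_a$ is the unit point mass at $a$. The symbol $\delta_\bullet^{u_n}$ denotes any best uniform $d_\epsilon$-approximation of $\mu$, that is, any $\delta_x^{u_n}$ with $x\in\Xi_n$ such that $d_\epsilon(\mu,\delta_x^{u_n})\le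 d_\epsilon(\mu,\delta_y^{u_n})$ for all $y\in\Xi_n$ (such a minimizer exists); thus $d_\epsilon(\mu,\delta_\bullet^{u_n})=\min_{x\in\Xi_n}d_\epsilon(\mu,\delta_x^{u_n})$. Inverse measure: let $F_\mu^{-1}(t)=\sup\{y\in\mathbb{R}:F_\mu(y)\le t\}\in[-\infty,+\infty]$ for $t\in\mathbb{R}$ (with $\sup\varnothing=-\infty$); it is non-decreasing, right-continuous, and real-valued on $(0,1)$. The inverse measure $\mu^{-1}$ is the $\sigma$-finite positive Borel measure on $\mathbb{R}$ with $\mu^{-1}(\mathbb{R}\setminus(0,1))=0$ and $\mu^{-1}((x,y])=F_\mu^{-1}(y)-F_\mu^{-1}(x)$ for all $0<x\le y<1$. For a $\sigma$-finite Borel measure $\rho$ on $\mathbb{R}$, $\rho=\rho_{\sf A}+\rho_{\sf S}$ is the unique decomposition with $\rho_{\sf A}$ absolutely continuous and $\rho_{\sf S}$ singular with respect to $\lambda$. The set $G_{(\mu^{-1})_{\sf S}}$ is the growth set associated with $(\mu^{-1})_{\sf S}$: the set of all $x\in\mathbb{R}$ with $g_{\sf S}(x-\varepsilon)<g_{\sf S}(x+\varepsilon)$ for every $\varepsilon>0$, where $g_{\sf S}:\mathbb{R}\to[-\infty,+\infty]$ is a non-decreasing right-continuous function that equals $-\infty$ on $(-\infty,0)$, equals $+\infty$ on $[1,\infty)$, is real-valued on $(0,1)$, and satisfies $(\mu^{-1})_{\sf S}((x,y])=g_{\sf S}(y)-g_{\sf S}(x)$ for $0<x\le y<1$. Equivalently,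 $G_{(\mu^{-1})_{\sf S}}=\{0,1\}\cup\mathrm{supp}\,(\mu^{-1})_{\sf S}\subset[0,1]$, where supp denotes closed support in $\mathbb{R}$. The function $\Omega$ is $\Omega(x)=\dfrac{x}{2+2|x|}$ for $x\in\mathbb{R}$, with $\Omega(\pm\infty)=\pm\frac12$. The function $\iota:\mathbb{R}\to\mathbb{N}_0\cup\{+\infty\}$ is $\iota(x)=2\inf\{n\in\mathbb{N}_0:(2n+1)x\in\mathbb{Z}\}$ (with $\inf\varnothing=+\infty$). $\|\cdot\|_\infty$ is the essential supremum norm with respect to $\lambda$. *)

(* Defs.v *)
From HB Require Import structures.
From mathcomp Require Import all_boot all_order all_algebra.
From mathcomp Require Import all_classical all_reals all_analysis measurable_realfun.

Set Implicit Arguments.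
Unset Strict Implicit.
Unset Printing Implicit Defensive.
Import Order.TTheory GRing.Theory Num.Theory.
Import numFieldNormedType.Exports.

Local Open Scope classical_set_scope.
Local Open Scope ring_scope.

Section Levy.
Context {R : realType}.
Implicit Types (mu nu : {measure set (measurableTypeR R) -> \bar R}) (eps x y : R).

Definition distr_fun mu x : R := fine (mu `]-oo, x]%classic).

Definition distr_fun_left mu x : R := fine (mu `]-oo, x[%classic).

Definition levy_dist eps mu nu : R :=
  inf [set y : R | 0 < y /\ forall x : R,
        distr_fun_left mu (x - y / eps) - y <= distr_fun nu x /\
        distr_fun nu x <= distr_fun mu (x + y / eps) + y].

End Levy.

Section UniformApproximation.
Context {R : realType}.

Definition Xi n : set (n.-tuple R) :=
  [set x | forall i j : 'I_n, (i <= j)%N -> tnth x i <= tnth x j].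

(* The zero measure when [n = 0]. *)
Definition delta_unif n (x : n.-tuple R) : {measure set (measurableTypeR R) -> \bar R} :=
  mscale (n%:R^-1 : R)%:nng (msum (fun j => @dirac _ (measurableTypeR R) x`_j R) n).

Definition best_unif_approx (eps : R) (mu : {measure set (measurableTypeR R) -> \bar R}) n
    (x : n.-tuple R) : Prop :=
  Xi x /\ forall y : n.-tuple R, Xi y ->
    levy_dist eps mu (delta_unif x) <= levy_dist eps mu (delta_unif y).

End UniformApproximation.

Section InverseMeasure.
Context {R : realType}.
Implicit Types (mu rho : {measure set (measurableTypeR R) -> \bar R}).

Local Open Scope ereal_scope.

Definition distr_inv mu (t : R) : \bar R :=
  ereal_sup [set y%:E | y in [set y : R | (distr_fun mu y <= t)%R]].

Definition inverse_measure mu rho : Prop :=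
  [/\ sigma_finite setT rho,
      rho (~` `]0%R, 1%R[%classic) = 0 &
      forall x y : R, (0 < x)%R -> (x <= y)%R -> (y < 1)%R ->
        rho `]x, y]%classic = distr_inv mu y - distr_inv mu x].

End InverseMeasure.

Section LebesgueDecomposition.
Context {R : realType}.
Implicit Types (rho rhoA rhoS : {measure set (measurableTypeR R) -> \bar R}).

Local Open Scope ereal_scope.

Definition singular_lebesgue rho : Prop :=
  exists N : set (measurableTypeR R),
    [/\ measurable N, lebesgue_measure N = 0 & rho (~` N) = 0].

Definition lebesgue_decomposition rho rhoA rhoS : Prop :=
  [/\ forall A, measurable A -> rho A = rhoA A + rhoS A,
      rhoA `<< @lebesgue_measure R &
      singular_lebesgue rhoS].

(* The library's Radon-Nikodym derivative is restricted to finite charges,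
   whereas the inverse measure may be infinite. *)
Definition lebesgue_RN_density rho (f : R -> \bar R) : Prop :=
  [/\ measurable_fun [set: R] f,
      forall t, 0 <= f t &
      forall A, measurable A -> rho A = \int[lebesgue_measure]_(t in A) f t].

End LebesgueDecomposition.

Section GrowthSet.
Context {R : realType}.

Local Open Scope ereal_scope.

(* [g 0] is only constrained by right-continuity: it is -oo exactly when [rho]
   has infinite mass near 0. *)
Definition growth_function (rho : {measure set (measurableTypeR R) -> \bar R}) (g : R -> \bar R) : Prop :=
  [/\ {homo g : x y / (x <= y)%R >-> x <= y},
      right_continuous g,
      (forall x : R, (x < 0)%R -> g x = -oo) /\
      (forall x : R, (1 <= x)%R -> g x = +oo),
      forall x : R, (0 < x)%R -> (x < 1)%R -> g x \is a fin_num &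
      forall x y : R, (0 < x)%R -> (x <= y)%R -> (y < 1)%R ->
        rho `]x, y]%classic = g y - g x].

Definition growth_set (g : R -> \bar R) : set R :=
  [set x | forall e : R, (0 < e)%R -> g (x - e)%R < g (x + e)%R].

End GrowthSet.

Section OmegaIota.
Context {R : realType}.

Definition Omega (x : \bar R) : \bar R :=
  match x with
  | r%:E => (r / (2 + 2 * `|r|))%:E
  | +oo%E => (2^-1)%:E
  | -oo%E => (- 2^-1)%:E
  end.

(* Valued in N0 with +oo, as [ereal_inf set0 = +oo]; [iota] is taken by [seq]. *)
Definition iota_odd (x : R) : \bar R :=
  (2%:E * ereal_inf [set n%:R%:E | n in
      [set n : nat | ((2 * n + 1)%:R * x)%R \is a Num.int]])%E.

End OmegaIota.

(* Main.v *)
Require Import Defs.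
From HB Require Import structures.
From mathcomp Require Import all_boot all_order all_algebra.
From mathcomp Require Import all_classical all_reals all_analysis measurable_realfun.
From mathcomp Require Import ess_sup_inf ring lra zify.
Set Implicit Arguments.
Unset Strict Implicit.
Unset Printing Implicit Defensive.
Import Order.TTheory GRing.Theory Num.Theory.
Import numFieldNormedType.Exports.
Local Open Scope classical_set_scope.
Local Open Scope ring_scope.

(** Let F be the distribution function of mu and Q its inverse. The Levy
    inequalities between mu and the uniform measure on x_1 <= ... <= x_n, with
    parameter y, constrain each atom separately: they say that x_j lies within
    y / eps of every point at which F climbs through the levels between
    (j - 1) / n + y and j / n - y. Such atoms exist as soon as, for each j, F
    needs a length of at most 2 y / eps to climb through this window of levels
    ([gap_bounded], where s = n y). So n times the optimal distance is the
    infimum of the s for which all windows ](j + s) / n, (j + 1 - s) / n[ have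
    mass at most 2 s / (n eps) under the inverse measure; in particular it is at
    most 1/2, where the windows become empty. This turns the theorem into a
    comparison of the inverse measure with Lebesgue measure on the windows
    ([central]), which have length (1 - 2 s) / n.

    Write d_n for the optimal distance. The right-hand side bounds n d_n for
    every n ([omega_bounds_gap_bounded]). Suppose that s < 1/2 is positive and
    an upper bound of it. A window contains only points t with
    s < Omega (iota t) ([central_lt_iota]): if m t is an integer for an odd m,
    then n t is a multiple of 1 / m, hence at distance at least 1 / (2 m) from
    all half-integers. Hence no window meets the growth set of the singular
    part, whose mass vanishes there. The density is at most
    2 s / (1 - 2 s) / eps, since Omega (eps r) <= s amounts to
    r <= 2 s / (1 - 2 s) / eps, and integrating this bound over a window gives
    exactly 2 s / (n eps).

    Conversely, suppose that n d_n < s for all large n, and let s < s' < 1/2. Every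
    t in ]0, 1[ with s' < Omega (iota t) lies in windows of arbitrarily large n
    ([central_infinitely_often]), because the multiples of t modulo 1 come
    close enough to 1/2 infinitely often. So the mass bound holds at
    arbitrarily small scales around t. If all points of an interval are of this
    kind, Q is Lipschitz on it ([quantile_lipschitz]), which leaves no room for
    a singular part ([lipschitz_null]): growth points satisfy
    Omega (iota t) <= s' ([eventually_growth_le]). Irrational points are always
    of this kind, and Lebesgue differentiation along the windows around them
    bounds the density almost everywhere ([eventually_density_le]). *)

(** * Windows and the function iota *)

Section Arithmetic.
Context {R : realType}.
Implicit Types (n j k : nat) (s x : R).

Lemma Omega_iota_rational x k :
  (2 * k + 1)%:R * x \is a Num.int ->
  (forall i, (2 * i + 1)%:R * x \is a Num.int -> (k <= i)%N) ->
  Omega (iota_odd x) = (k%:R / (2 * k + 1)%:R)%:E.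
Proof.
move=> kx kmin; rewrite /iota_odd (_ : ereal_inf _ = k%:R%:E); last first.
  apply/eqP; rewrite eq_le; apply/andP; split.
    by apply: ereal_inf_lbound; exists k.
  by apply: le_ereal_inf_tmp => _ [i /kmin ki <-]; rewrite lee_fin ler_nat.
rewrite -EFinM /Omega ger0_norm ?mulr_ge0// natrD natrM; congr EFin.
have k0 : 0 <= k%:R :> R by [].
by field; apply/andP; split; rewrite gt_eqF//; lra.
Qed.

Lemma Omega_iota_irrational x :
  (forall k, (2 * k + 1)%:R * x \isn't a Num.int) ->
  Omega (iota_odd x) = (2^-1)%:E.
Proof.
move=> xk; rewrite /iota_odd (_ : [set n | _] = set0).
  by rewrite image_set0 ereal_inf0 mulry gtr0_sg// mul1e.
by apply/seteqP; split => // k /=; apply/negP.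
Qed.

(** The value of [Omega] at [iota] is k / (2 k + 1) for the least k making
    (2 k + 1) x an integer, and k / (2 k + 1) increases with k. Quantifying over
    all such k spares the least one, and the rational and irrational cases. *)
Lemma lt_Omega_iotaP s x : (s%:E < Omega (iota_odd x))%E <->
  s < 2^-1 /\
  forall k, (2 * k + 1)%:R * x \is a Num.int -> s * (2 * k + 1)%:R < k%:R.
Proof.
have [[k0 xk0]|xk] := pselect (exists k, (2 * k + 1)%:R * x \is a Num.int); last first.
  have xk' k : (2 * k + 1)%:R * x \isn't a Num.int.
    by apply/negP => ?; apply: xk; exists k.
  rewrite Omega_iota_irrational// lte_fin; split=> [|[]//].
  by move=> s2; split => // k; rewrite (negbTE (xk' k)).
have exk : exists k, (2 * k + 1)%:R * x \is a Num.int by exists k0.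
case: (ex_minnP exk) => k xk kmin.
have e i : (2 * i).+1%:R = 2 * i%:R + 1 :> R by rewrite -addn1 natrD natrM.
rewrite (Omega_iota_rational xk kmin) lte_fin ltr_pdivlMr ?ltr0n ?addn1//.
split=> [sk|[_ /(_ k xk)]]; last by rewrite addn1.
have k1 : 0 <= k%:R :> R by [].
have sh : s < 2^-1.
  by move: sk; rewrite e => sk; nra.
split=> // i /kmin; rewrite -(ler_nat R) => ki.
by move: sk; rewrite e addn1 e => sk; nra.
Qed.

(** The window ](j + s) / n, (j + 1 - s) / n[ of the (j + 1)-st cell
    of the partition of the unit interval into n cells. *)
Definition central n s j x := j%:R + s < n%:R * x < j.+1%:R - s.

(** If m x = p with m = 2 k + 1, then d = n p - m j is an integer in
    ]m s, m - m s[. Either d <= k, so that m s < k, or d >= k + 1, so that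
    m s < m - (k + 1) = k. *)
Lemma central_lt_iota n s j x : 0 < s -> central n s j x ->
  (s%:E < Omega (iota_odd x))%E.
Proof.
move=> s0 /andP[jx xj]; apply/lt_Omega_iotaP.
split; first by move: xj; rewrite -natr1; lra.
move=> k /intrP[p xp].
have m0 : 0 < (2 * k + 1)%:R :> R by rewrite ltr0n addn1.
pose d : int := (n%:Z * p - (2 * k + 1)%:Z * j%:Z)%R.
have dE : d%:~R = (2 * k + 1)%:R * (n%:R * x - j%:R) :> R.
  rewrite /d rmorphB/= !rmorphM/= -xp; ring.
have dl : (2 * k + 1)%:R * s < d%:~R by rewrite dE ltr_pM2l//; lra.
have du : d%:~R < (2 * k + 1)%:R * (1 - s).
  by rewrite dE ltr_pM2l//; move: xj; rewrite -natr1; lra.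
have [dk|kd] := lerP d k%:Z.
  rewrite mulrC (lt_le_trans dl)//.
  by rewrite -(ler_int R) in dk.
have : (k%:R + 1 : R) <= d%:~R.
  by rewrite -[k%:R + 1]/((k%:~R + 1%:~R) : R) -rmorphD/= ler_int; lia.
by move: du; rewrite natrD natrM; lra.
Qed.

Lemma central_sub n s s' j x : s <= s' -> central n s' j x -> central n s j x.
Proof. by rewrite /central => ss /andP[? ?]; apply/andP; split; lra. Qed.

End Arithmetic.

(** * Multiples of a number close to half-integers *)

Section Density.
Context {R : realType}.
Implicit Types (n j k m : nat) (s x : R).

(** Among the fractional parts of 0, x, ..., N x, two lie in the same of the N
    intervals of length 1 / N. *)
Lemma dirichlet_approx x (d : R) : 0 < d ->
  exists m (p : int), (0 < m)%N /\ `|m%:R * x - p%:~R| < d.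
Proof.
move=> d0; pose N := (Num.trunc d^-1).+1.
have Nd : N%:R^-1 < d.
  by rewrite invf_plt ?posrE ?ltr0n// truncnS_gt.
have N0 : 0 < N%:R :> R by rewrite ltr0n.
pose fr (i : nat) : R := i%:R * x - (Num.floor (i%:R * x))%:~R.
have fr0 i : 0 <= fr i by rewrite subr_ge0 floor_le.
have fr1 i : fr i < 1.
  by rewrite /fr ltrBlDl -[X in _ + X]/(1%:~R) -intrD floorD1_gt.
have Nfr0 i : 0 <= N%:R * fr i by rewrite mulr_ge0// ltW.
have trN i : (Num.trunc (N%:R * fr i) < N)%N.
  by rewrite truncn_lt_nat// -[ltRHS]mulr1 ltr_pM2l.
pose h (i : 'I_N.+1) : 'I_N := Ordinal (trN i).
have : ~~ injectiveb h.
  by apply/negP => /injectiveP /leq_card; rewrite !card_ord ltnn.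
move=> /injectivePn[i1 [i2 i12 hE]].
wlog lti : i1 i2 i12 hE / (i1 < i2)%N.
  move=> H; have [?|?|/val_inj e] := ltngtP i1 i2; first exact: (H i1 i2).
    by apply: (H i2 i1) => //; rewrite eq_sym.
  by rewrite e eqxx in i12.
exists (i2 - i1)%N, (Num.floor (i2%:R * x) - Num.floor (i1%:R * x)).
split; first by rewrite subn_gt0.
apply: lt_trans Nd.
have -> : (i2 - i1)%:R * x - (Num.floor (i2%:R * x) - Num.floor (i1%:R * x))%:~R
    = fr i2 - fr i1.
  by rewrite /fr natrB 1?ltnW// rmorphB/=; ring.
rewrite -(ltr_pM2l N0) mulfV ?gt_eqF// -[N%:R in ltLHS]ger0_norm ?ltW//.
rewrite -normrM mulrBr ltr_norml.
have /andP[a1 b1] := truncn_itv (Nfr0 i1).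
have /andP[a2 b2] := truncn_itv (Nfr0 i2).
have e : Num.trunc (N%:R * fr i1) = Num.trunc (N%:R * fr i2).
  by have /(congr1 val) := hE.
by move: b1 b2 a1 a2; rewrite e -natr1; lra.
Qed.

(** It suffices to look for an integer: its bounds follow from 0 < n x < n. *)
Lemma central_int n s (J : int) x : 0 <= s -> 0 < x < 1 -> (0 < n)%N ->
  J%:~R + s < n%:R * x < J%:~R + 1 - s ->
  exists j, (j < n)%N /\ central n s j x.
Proof.
move=> s0 /andP[x0 x1] n0 /andP[Jx xJ].
have n0' : 0 < n%:R :> R by rewrite ltr0n.
have nx0 : 0 < n%:R * x by rewrite mulr_gt0.
have nxn : n%:R * x < n%:R by rewrite -[ltRHS]mulr1 ltr_pM2l.
have J0 : (0 <= J)%R.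
  rewrite -ltzD1 -(ltr_int R) rmorphD/=; lra.
move: J J0 Jx xJ => [j|//] _ Jx xJ; exists j; split.
  by rewrite -(ltr_nat R); rewrite -pmulrn in Jx; lra.
by rewrite /central -natr1; apply/andP; split.
Qed.

(** The small nonzero rotation angle t = m x - p cannot jump over the interval
    of radius 1/2 - s around a half-integer, so some multiple k |t| falls into
    the one around N + 3/2; then n = k m works and is large. *)
Lemma central_irrational s x m (p : int) N :
  0 <= s -> 0 < x < 1 -> (0 < m)%N -> m%:R * x != p%:~R ->
  `|m%:R * x - p%:~R| < 2^-1 - s ->
  exists n j, [/\ (N <= n)%N, (j < n)%N & central n s j x].
Proof.
move=> s0 x01 m0 xp; set t := m%:R * x - p%:~R => ts.
have t0 : 0 < `|t| by rewrite normr_gt0 subr_eq0.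
pose c : R := N.+1%:R + 2^-1.
have c0 : 0 <= c / `|t| by rewrite divr_ge0// addr_ge0.
pose k := Num.trunc (c / `|t|).
have /andP[kc ck] := truncn_itv c0.
move: kc ck; rewrite -/k ler_pdivlMr// ltr_pdivrMr// -natr1 mulrDl mul1r => kc ck.
have Nk : (N < k)%N.
  rewrite -ltnS -(ltr_nat R) -(ltr_pM2r t0).
  have Nt : N.+1%:R * `|t| <= N.+1%:R by rewrite ler_piMr//; lra.
  by move: ck; rewrite /c -[k.+1%:R]natr1 => ck; lra.
have n0 : (0 < k * m)%N by rewrite muln_gt0 m0 andbT (leq_ltn_trans _ Nk).
have nx : (k * m)%:R * x = k%:R * p%:~R + k%:R * t.
  by rewrite /t natrM; ring.
have Nn : (N <= k * m)%N.
  by rewrite (leq_trans (ltnW Nk))// leq_pmulr.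
have [J HJ] : exists J : int,
    J%:~R + s < (k * m)%:R * x < J%:~R + 1 - s.
  have [t1|t1] := lerP 0 t.
    move: kc ck ts; rewrite ger0_norm// => kc ck ts.
    exists (k%:Z * p + N.+1%:Z); rewrite nx rmorphD rmorphM/= -!pmulrn.
    move: kc ck; rewrite /c => kc ck; apply/andP; split; lra.
  move: kc ck ts; rewrite ltr0_norm// => kc ck ts.
  exists (k%:Z * p - N.+1%:Z - 1); rewrite nx !rmorphB rmorphM/= -!pmulrn.
  move: kc ck; rewrite /c => kc ck; apply/andP; split; lra.
have [j [jn cj]] := central_int s0 x01 n0 HJ.
by exists (k * m)%N, j.
Qed.

(** By Bezout, the multiples of the reduced fraction p / m attain the value
    m./2 / m modulo 1, the nearest to 1/2 among the multiples of 1 / m, once in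
    every m consecutive steps. *)
Lemma central_rational s x m p N :
  s < 2^-1 -> 0 <= s -> 0 < x < 1 -> (0 < m)%N -> (0 < p)%N -> coprime p m ->
  m%:R * x = p%:R -> s * m%:R < (m./2)%:R ->
  exists n j, [/\ (N <= n)%N, (j < n)%N & central n s j x].
Proof.
move=> s2 s0 x01 m0 p0 /(coprimeP _ p0)[[u v]/= uv] xp sm.
have m0' : 0 < m%:R :> R by rewrite ltr0n.
have uvE : (u * p = 1 + v * m)%N by lia.
pose k := m./2; pose n := (u * k + m * N.+1)%N.
have nx : m%:R * (n%:R * x) = m%:R * (v * k + p * N.+1)%:R + k%:R.
  rewrite mulrCA xp -!natrM -natrD; congr (_%:R).
  by rewrite /n mulnDl -mulnA [(k * p)%N]mulnC mulnA uvE; lia.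
have n0 : (0 < n)%N by rewrite /n; nia.
have k2 : (2 * k)%:R <= m%:R :> R by rewrite ler_nat /k; lia.
move: k2; rewrite natrM => k2.
have [j [jn cj]] : exists j, (j < n)%N /\ central n s j x.
  apply: (@central_int n s (v * k + p * N.+1)%:Z) => //.
  rewrite -pmulrn.
  rewrite -(ltr_pM2l m0') -[_ < _ + 1 - s](ltr_pM2l m0') nx.
  rewrite !mulrDr mulr1; apply/andP; split; first by rewrite ltrD2l mulrC.
  by rewrite -addrA ltrD2l; nra.
by exists n, j; split => //; rewrite /n; nia.
Qed.

(** In lowest terms x = p / q: for even q the point 1/2 itself is a multiple of x
    modulo 1, for odd q = 2 k + 1 the hypothesis says that s < k / q. *)
Lemma central_infinitely_often s x : 0 <= s -> 0 < x < 1 ->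
  (s%:E < Omega (iota_odd x))%E ->
  forall N, exists n j, [/\ (N <= n)%N, (j < n)%N & central n s j x].
Proof.
move=> s0 x01 /lt_Omega_iotaP[s2 sx] N.
have [[m [p [m0 xp]]]|irr] := pselect (exists m p, (0 < m)%N /\ m%:R * x = p%:~R :> R).
  have m0' : 0 < m%:R :> R by rewrite ltr0n.
  have /andP[x0 x1] := x01.
  have p0 : (0 < p) by rewrite -(ltr_int R) -xp mulr_gt0.
  move: p p0 xp => [p|//] p0 xp; rewrite -pmulrn in xp.
  pose g := gcdn p m; have g0 : (0 < g)%N by rewrite gcdn_gt0 m0 orbT.
  have pg : (p %/ g * g = p)%N by rewrite divnK ?dvdn_gcdl.
  have mg : (m %/ g * g = m)%N by rewrite divnK ?dvdn_gcdr.
  have cop : coprime (p %/ g) (m %/ g).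
    by rewrite /coprime -(eqn_pmul2r g0) muln_gcdl pg mg mul1n.
  have g0' : 0 < g%:R :> R by rewrite ltr0n.
  have xg : (m %/ g)%:R * x = (p %/ g)%:R.
    have gN0 : g%:R != 0 :> R by rewrite gt_eqF.
    apply: (mulIf gN0).
    by rewrite mulrAC -!natrM mg pg.
  have mg0 : (0 < m %/ g)%N by move: m0; rewrite -{1}mg muln_gt0 => /andP[].
  have pg0 : (0 < p %/ g)%N by move: p0; rewrite ltz_nat -{1}pg muln_gt0 => /andP[].
  apply: (central_rational N s2 s0 x01 mg0 pg0 cop xg).
  move: (m %/ g)%N mg0 xg => q q0 xq.
  have [oq|eq] := boolP (odd q).
    have qE : q = (2 * q./2 + 1)%N by rewrite -{1}(odd_double_half q) oq mul2n addnC.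
    by rewrite {1}qE; apply: sx; rewrite -qE xq natr_int.
  have qE : q = (2 * q./2)%N by rewrite -{1}(odd_double_half q) (negbTE eq) mul2n add0n.
  have : 0 < q%:R :> R by rewrite ltr0n.
  by rewrite {1 2}qE natrM; nra.
have d0 : 0 < 2^-1 - s by rewrite subr_gt0.
have [m [p [m0 mp]]] := dirichlet_approx x d0.
apply: (central_irrational N s0 x01 m0 _ mp).
by apply/eqP => xp; apply: irr; exists m, p.
Qed.

End Density.

(** * Distribution functions *)

Section DistributionFunction.
Context {R : realType} (mu : probability (measurableTypeR R) R).
Implicit Types (x y z w c : R).

Local Notation F := (distr_fun mu).

Lemma distr_fun_homo : {homo F : z w / z <= w}.
Proof.
move=> z w zw; rewrite /distr_fun fine_le ?fin_num_measure//.
by rewrite le_measure ?inE//; exact: subitvPr.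
Qed.

Lemma distr_fun_ge0 z : 0 <= F z.
Proof. by apply: fine_ge0; exact: measure_ge0. Qed.

Lemma distr_fun_left_le_distr_fun z : distr_fun_left mu z <= F z.
Proof.
rewrite /distr_fun /distr_fun_left fine_le ?fin_num_measure//.
rewrite le_measure ?inE// => u/=.
by rewrite !in_itv/=; exact: ltW.
Qed.

Lemma distr_fun_le_left w z : w < z -> F w <= distr_fun_left mu z.
Proof.
move=> wz; rewrite /distr_fun /distr_fun_left fine_le ?fin_num_measure//.
rewrite le_measure ?inE// => u/=.
by rewrite !in_itv/= => /le_lt_trans; exact.
Qed.

Lemma distr_fun_le1 z : F z <= 1.
Proof.
rewrite /distr_fun -[leRHS]/(fine 1%E) fine_le ?fin_num_measure//.
by rewrite probability_le1.
Qed.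

(* The identity of the line is a random variable with distribution mu. *)
Let X : measurableTypeR R -> R := fun t => t.
HB.instance Definition _ := @isMeasurableFun.Build _ _ (measurableTypeR R) R X
  (@measurable_id _ (measurableTypeR R) setT).
Let id_RV : {RV mu >-> R} := X.

Lemma distr_fun_gt c : c < 1 -> exists z, c < F z.
Proof.
move=> c1; have /fine_cvg/cvgr_gt/(_ c c1) H := cvg_cdfy1 id_RV.
by have [z cz] := filter_ex H; exists z.
Qed.

Lemma distr_fun_lt c : 0 < c -> exists z, F z < c.
Proof.
move=> c0; have /fine_cvg/cvgr_lt/(_ c c0) H := cvg_cdfNy0 id_RV.
by have [z cz] := filter_ex H; exists z.
Qed.

End DistributionFunction.

Section UniformMeasure.
Context {R : realType} (n : nat) (x : n.-tuple R).
Implicit Types (j : 'I_n) (t : R).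

Let natoms t := (\sum_(i < n) (x`_i <= t)%R)%N.

Lemma distr_fun_delta_unif t : distr_fun (delta_unif x) t = (natoms t)%:R / n%:R.
Proof.
rewrite /distr_fun /delta_unif/= /mscale/= /msum/=.
under eq_bigr do rewrite diracE.
rewrite (eq_bigr (fun i : 'I_n => ((x`_i <= t)%R%:R)%:E)); last first.
  move=> i _; congr (_%:R%:E).
  by congr nat_of_bool; apply/idP/idP; rewrite ?inE/= in_itv.
by rewrite sumEFin -EFinM/= mulrC natr_sum.
Qed.

Hypothesis sx : Xi x.

Let natoms_ge j t : tnth x j <= t -> (j < natoms t)%N.
Proof.
move=> jt.
have -> : j.+1 = (\sum_(i < n) (i <= j)%N)%N.
  rewrite -(big_mkord xpredT (fun i => (i <= j)%N : nat)).
  rewrite (@big_cat_nat _ _ _ j.+1)//=.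
  rewrite (@eq_big_nat _ _ _ 0 _ _ (fun=> 1%N)); last first.
    by move=> i /andP[_]; rewrite ltnS => ->.
  rewrite sum_nat_const_nat subn0 muln1 big_nat big1 ?addn0// => i /andP[ji _].
  by rewrite leqNgt ji.
apply: leq_sum => i _; case: (leqP i j) => // ij.
by rewrite -tnth_nth (le_trans (sx ij) jt).
Qed.

Let natoms_le j t : t < tnth x j -> (natoms t <= j)%N.
Proof.
move=> jt.
have -> : (j : nat) = (\sum_(i < n) (i < j)%N)%N.
  rewrite -(big_mkord xpredT (fun i => (i < j)%N : nat)).
  rewrite (@big_cat_nat _ _ _ j) ?(ltnW (ltn_ord j))//=.
  rewrite (@eq_big_nat _ _ _ 0 _ _ (fun=> 1%N)); last first.
    by move=> i /andP[_] ->.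
  rewrite sum_nat_const_nat subn0 muln1 big_nat big1 ?addn0// => i /andP[ji _].
  by rewrite ltnNge ji.
apply: leq_sum => i _; case: (ltnP i j) => // ij; first by case: (_ <= _).
by rewrite -tnth_nth leNgt (lt_le_trans jt (sx ij)).
Qed.

Lemma distr_fun_delta_unif_ge j t : tnth x j <= t ->
  j.+1%:R <= n%:R * distr_fun (delta_unif x) t.
Proof.
have n0 : n%:R != 0 :> R by rewrite pnatr_eq0 -lt0n (leq_ltn_trans _ (ltn_ord j)).
by move=> /natoms_ge jt; rewrite distr_fun_delta_unif mulrC divfK// ler_nat.
Qed.

Lemma distr_fun_delta_unif_le j t : t < tnth x j ->
  n%:R * distr_fun (delta_unif x) t <= j%:R.
Proof.
have n0 : n%:R != 0 :> R by rewrite pnatr_eq0 -lt0n (leq_ltn_trans _ (ltn_ord j)).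
by move=> /natoms_le jt; rewrite distr_fun_delta_unif mulrC divfK// ler_nat.
Qed.

(** As the atoms are sorted, those up to t are the first k ones. The Levy
    inequalities at t thus only involve the atoms of ranks k and k + 1. *)
Lemma distr_fun_delta_unifP t : (0 < n)%N -> exists k,
  [/\ n%:R * distr_fun (delta_unif x) t = k%:R, (k <= n)%N,
      forall j, j.+1 = k -> tnth x j <= t & forall j, j = k :> nat -> t < tnth x j].
Proof.
move=> n_gt0; have n0 : n%:R != 0 :> R by rewrite pnatr_eq0 -lt0n.
exists (natoms t); split.
- by rewrite distr_fun_delta_unif mulrC divfK.
- rewrite -[leqRHS]card_ord -sum1_card; apply: leq_sum => i _; exact: leq_b1.
- by move=> j jk; rewrite leNgt; apply/negP => /natoms_le; rewrite -jk ltnn.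
- by move=> j jk; rewrite ltNge; apply/negP => /natoms_ge; rewrite -jk ltnn.
Qed.

End UniformMeasure.

(** * Levy distance to uniform measures *)

Section UniformQuantization.
Context {R : realType} (mu : probability (measurableTypeR R) R) (eps : R).
Hypothesis eps_gt0 : 0 < eps.
Implicit Types (x y z w s t : R) (n j : nat).

Local Notation F := (distr_fun mu).

Definition levy_close y (nu : {measure set (measurableTypeR R) -> \bar R}) :=
  forall t, distr_fun_left mu (t - y / eps) - y <= distr_fun nu t /\
    distr_fun nu t <= F (t + y / eps) + y.

(** With levels multiplied by n, F climbs through the window
    ](j + s) / n, (j + 1 - s) / n[ over a length of at most 2 s / (n eps). Saying
    this by points below and above the window avoids one-sided inverses of F,
    and makes sense when the window is empty. *)
Definition gap_bounded n s := forall j z w, (j < n)%N ->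
  n%:R * F z < j.+1%:R - s -> j%:R + s < n%:R * F w ->
  z - w <= 2 * s / (n%:R * eps).

(** At s = 1/2 the window is empty and z < w by monotonicity. *)
Lemma gap_bounded_half n : gap_bounded n 2^-1.
Proof.
move=> j z w jn zj jw.
have n0 : 0 < n%:R :> R by rewrite ltr0n (leq_ltn_trans _ jn).
have zw : z < w.
  rewrite ltNge; apply/negP => /(distr_fun_homo mu).
  by rewrite -(ler_pM2l n0); move: zj; rewrite -natr1; lra.
have : 0 <= 2 * 2^-1 / (n%:R * eps) by rewrite divr_ge0// mulr_ge0 ?ltW.
by lra.
Qed.

(** The upper inequality at the atom x_j gives z < x_j + y / eps; the lower one at
    points just below x_j gives x_j <= w + y / eps. *)
Lemma levy_close_gap_bounded n y (x : n.-tuple R) : Xi x ->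
  levy_close y (delta_unif x) -> gap_bounded n (n%:R * y).
Proof.
move=> sx xy j z w jn zj jw.
have n0 : 0 < n%:R :> R by rewrite ltr0n (leq_ltn_trans _ jn).
pose i := Ordinal jn.
have -> : 2 * (n%:R * y) / (n%:R * eps) = y / eps + y / eps.
  by field; rewrite !gt_eqF.
have zx : z < tnth x i + y / eps.
  have [_ H] := xy (tnth x i).
  have /= := distr_fun_delta_unif_ge sx (lexx (tnth x i)).
  rewrite ltNge => ix; apply/negP => /(distr_fun_homo mu) Fxz.
  have := ler_wpM2l (ltW n0) (le_trans H (lerD Fxz (lexx y))).
  by rewrite mulrDr; lra.
have xw t : t < tnth x i -> t <= w + y / eps.
  move=> /(distr_fun_delta_unif_le sx)/= ti.
  rewrite leNgt -ltrBDr; apply/negP => /(distr_fun_le_left mu) Fwt.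
  have [H _] := xy t.
  have := ler_wpM2l (ltW n0) (le_trans (lerB Fwt (lexx y)) H).
  by rewrite mulrBr; lra.
have : tnth x i <= w + y / eps.
  rewrite leNgt; apply/negP => wx.
  have := xw ((w + y / eps + tnth x i) / 2); lra.
by lra.
Qed.

Lemma gap_bounded_le n s s' : s <= s' -> gap_bounded n s -> gap_bounded n s'.
Proof.
move=> ss' gs j z w jn zj jw.
have n0 : 0 < n%:R :> R by rewrite ltr0n (leq_ltn_trans _ jn).
apply: (le_trans (gs j z w jn _ _)); [lra|lra|].
by rewrite ler_pM2r ?ler_pM2l// invr_gt0 mulr_gt0.
Qed.

Section Witness.
Variables (n : nat) (s : R).
Hypotheses (n_gt0 : (0 < n)%N) (s_gt0 : 0 < s) (ns : gap_bounded n s).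

Let h := s / (n%:R * eps).

(* The atom x_j has to lie above all z - h with z below the j-th window, and
   below all w + h with w above it. There may be no such z or no such w; adding
   the points below 0 keeps the set nonempty, and the supremum is nondecreasing
   in j since the set is. *)
Let A j : set R := [set t |
  (exists2 z, n%:R * F z < j.+1%:R - s & t = z - h) \/
  (t <= 0 /\ forall w, j%:R + s < n%:R * F w -> t <= w + h)].

Let n0 : 0 < n%:R :> R. Proof. by rewrite ltr0n. Qed.

Let A_le j t w : (j < n)%N -> A j t -> j%:R + s < n%:R * F w -> t <= w + h.
Proof.
move=> jn [[z zj ->] jw|[_ + jw]]; last exact.
have := ns jn zj jw; rewrite /h -mulrA; lra.
Qed.

Let A_ubound j : (j < n)%N -> has_ubound (A j).
Proof.
move=> jn; have [z0 z0j] : exists z, (j.+1%:R - s) / n%:R < F z.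
  apply: distr_fun_gt; rewrite ltr_pdivrMr// mul1r.
  by rewrite (lt_le_trans (_ : _ < j.+1%:R)) ?ltrBlDr ?ltrDl// ler_nat.
exists (Num.max 0 (z0 - h)) => t [[z zj ->]|[t0 _]]; last by rewrite le_max t0.
rewrite le_max; apply/orP; right; rewrite lerD2r leNgt.
apply/negP => /ltW /(distr_fun_homo mu) z0z.
move: z0j; rewrite ltr_pdivrMr// mulrC => z0j.
have := ler_wpM2l (ltW n0) z0z; lra.
Qed.

Let A_nonempty j : A j !=set0.
Proof.
have [w0 w0j] : exists w, F w < (j%:R + s) / n%:R.
  by apply: distr_fun_lt; rewrite divr_gt0// ltr_wpDl.
have h0 : 0 <= h by rewrite divr_ge0 ?mulr_ge0// ltW.
exists (Num.min 0 w0); right; split; first by rewrite ge_min lexx.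
move=> w jw; rewrite ge_min; apply/orP; right.
have : w0 <= w.
  rewrite leNgt; apply/negP => /ltW /(distr_fun_homo mu) ww0.
  move: w0j; rewrite ltr_pdivlMr// mulrC => w0j.
  have := ler_wpM2l (ltW n0) ww0; lra.
by lra.
Qed.

Let A_sub i j : (i <= j)%N -> A i `<=` A j.
Proof.
rewrite -(ler_nat R) => ij t [[z zi ->]|[t0 ti]]; [left|right].
  by exists z => //; apply: lt_le_trans zi _; rewrite -!natr1; lra.
by split=> // w jw; apply: ti; lra.
Qed.

Let x : n.-tuple R := [tuple sup (A j) | j < n].

(** Asking for the Levy inequalities only at parameters larger than s / n avoids
    the one-sided continuity of F. *)
Lemma gap_bounded_levy_close :
  exists2 x : n.-tuple R, Xi x & forall y, s / n%:R < y -> levy_close y (delta_unif x).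
Proof.
have x_ge (i : 'I_n) z : n%:R * F z < i.+1%:R - s -> z - h <= tnth x i.
  move=> zi; rewrite tnth_mktuple; apply: ub_le_sup; first exact: A_ubound.
  by left; exists z.
have x_le (i : 'I_n) w : i%:R + s < n%:R * F w -> tnth x i <= w + h.
  move=> iw; rewrite tnth_mktuple; apply: ge_sup; first exact: A_nonempty.
  by move=> t At; exact: (A_le (ltn_ord i)).
have sx : Xi x.
  move=> i j ij; rewrite !tnth_mktuple; apply: ge_sup; first exact: A_nonempty.
  move=> t At; apply: ub_le_sup; first exact: A_ubound.
  exact: A_sub At.
exists x => // y sy.
have hy : h < y / eps by rewrite /h invfM mulrA ltr_pM2r ?invr_gt0.
have ny : s < n%:R * y by move: sy; rewrite ltr_pdivrMr// mulrC.
have y0 : 0 < y by apply: lt_trans sy; rewrite divr_gt0.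
move=> t; have [k [nk kn xk kx]] := distr_fun_delta_unifP sx t n_gt0.
split.
- rewrite -(ler_pM2l n0) nk mulrBr lerBlDr.
  move: kn; rewrite leq_eqVlt => /predU1P[->|kn].
    have := ler_wpM2l (ltW n0) (le_trans
      (distr_fun_left_le_distr_fun mu (t - y / eps)) (distr_fun_le1 mu _)).
    by rewrite mulr1; have := s_gt0; lra.
  rewrite leNgt; apply/negP => kF.
  have tx := kx (Ordinal kn) erefl.
  have := x_le (Ordinal kn) (t - y / eps) _.
  have := ler_wpM2l (ltW n0) (distr_fun_left_le_distr_fun mu (t - y / eps)).
  move=> FF /= H; have : tnth x (Ordinal kn) <= t - y / eps + h by apply: H; lra.
  by lra.
- rewrite -(ler_pM2l n0) nk mulrDr.
  case: k kn xk {nk kx} => [_ _|k kn xk].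
    by rewrite addr_ge0 ?mulr_ge0 ?distr_fun_ge0// ltW.
  rewrite leNgt; apply/negP => Fk.
  have tx := xk (Ordinal kn) erefl.
  have /= H := x_ge (Ordinal kn) (t + y / eps).
  have : t + y / eps - h <= tnth x (Ordinal kn) by apply: H; lra.
  by lra.
Qed.

End Witness.

Let levy_set_lbound nu : has_lbound [set y | 0 < y /\ levy_close y nu].
Proof. by exists 0 => y [/ltW]. Qed.

Lemma gap_bounded_levy_dist n s (x : n.-tuple R) : (0 < n)%N -> 0 < s ->
  best_unif_approx eps mu x -> gap_bounded n s ->
  n%:R * levy_dist eps mu (delta_unif x) <= s.
Proof.
move=> n0 s0 [_ xbest] ns.
have n0' : 0 < n%:R :> R by rewrite ltr0n.
have [x' sx' x'y] := gap_bounded_levy_close n0 s0 ns.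
rewrite mulrC -ler_pdivlMr// (le_trans (xbest _ sx'))//.
apply/ler_addgt0Pr => e e0.
apply: ge_inf; first exact: levy_set_lbound.
have sn : 0 < s / n%:R by rewrite divr_gt0.
by split; [rewrite addr_gt0|apply: x'y; rewrite ltrDl].
Qed.

Lemma levy_dist_gap_bounded n s (x : n.-tuple R) : (0 < n)%N ->
  best_unif_approx eps mu x ->
  n%:R * levy_dist eps mu (delta_unif x) < s -> gap_bounded n s.
Proof.
move=> n0 [sx _]; have n0' : 0 < n%:R :> R by rewrite ltr0n.
rewrite mulrC -ltr_pdivlMr// => ds.
have [|y [y0 yx] ys] := inf_lt _ ds.
  (* The infimum is meaningful since the parameter 1 is always admissible. *)
  exists 1; split=> // t; split.
    by rewrite lerBlDr (le_trans (distr_fun_left_le_distr_fun mu _))//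
      (le_trans (distr_fun_le1 mu _))// lerDr distr_fun_delta_unif divr_ge0.
  rewrite ler_wpDl ?distr_fun_ge0// distr_fun_delta_unif ler_pdivrMr// mul1r.
  by rewrite ler_nat -[leqRHS]card_ord -sum1_card; apply: leq_sum => i _; exact: leq_b1.
apply: (@gap_bounded_le _ (n%:R * y)); first by rewrite mulrC -ler_pdivlMr// ltW.
exact: levy_close_gap_bounded yx.
Qed.

End UniformQuantization.

(** * Quantiles and Lipschitz bounds *)

Section RealInduction.
Context {R : realType}.

(** The supremum of the points of [a, b] at which [P] holds belongs to them by
    left-closedness, and equals b since it can be passed otherwise. *)
Lemma real_induction (P : R -> Prop) (a b : R) : a <= b -> P a ->
  (forall t, a < t <= b ->
    (forall u, u < t -> exists v, [/\ u < v, a <= v < t & P v]) -> P t) ->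
  (forall t, a <= t < b -> P t -> exists2 r, t < r <= b & P r) ->
  P b.
Proof.
move=> ab Pa Plim Pstep.
pose S := [set t | a <= t <= b /\ P t].
have Sa : S a by split=> //; rewrite lexx.
have Sub : has_ubound S by exists b => t [/andP[]].
have St t : S t -> t <= sup S by move=> ?; exact: ub_le_sup.
have aS : a <= sup S by exact: St.
have Sb : sup S <= b by apply: ge_sup; [exists a|move=> t [/andP[]]].
have PS : P (sup S).
  have [<-//|aNS] := eqVneq a (sup S).
  have aS' : a < sup S by rewrite lt_neqAle aNS.
  have [//|nPS] := pselect (P (sup S)).
  apply: Plim; first by rewrite aS'.
  move=> u uS; have [|v Sv uv] := @sup_gt _ S u _ uS; first by exists a.
  have [/andP[av vb] Pv] := Sv.
  exists v; split=> //; rewrite av lt_neqAle St// andbT.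
  by apply/eqP => vS; apply: nPS; rewrite -vS.
have [<-//|Sb'] := eqVneq (sup S) b.
have [|r /andP[Sr rb] Pr] := Pstep _ _ PS.
  by rewrite aS lt_neqAle Sb'.
have : S r by split=> //; rewrite rb (le_trans aS (ltW Sr)).
by move=> /St; rewrite leNgt Sr.
Qed.

End RealInduction.

Section Quantile.
Context {R : realType} (mu : probability (measurableTypeR R) R) (eps : R).
Hypothesis eps_gt0 : 0 < eps.
Implicit Types (x y z w s t a b : R) (n j : nat).

Local Notation F := (distr_fun mu).

(** The inverse of F as a real number, meaningful for 0 < t < 1. *)
Definition quantile t := sup [set z | F z <= t].

Lemma has_sup_quantile t : 0 < t < 1 -> has_sup [set z | F z <= t].
Proof.
move=> /andP[t0 t1]; split.
  by have [w /ltW wt] := distr_fun_lt mu t0; exists w.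
have [z tz] := distr_fun_gt mu t1; exists z => w /= wt.
rewrite leNgt; apply/negP => /ltW /(distr_fun_homo mu) zw.
by move: tz; rewrite ltNge (le_trans zw wt).
Qed.

Lemma distr_inv_quantile t : 0 < t < 1 -> distr_inv mu t = (quantile t)%:E.
Proof. by move=> /has_sup_quantile[? ?]; rewrite /distr_inv ereal_sup_EFin. Qed.

Lemma le_quantile t z : 0 < t < 1 -> F z <= t -> z <= quantile t.
Proof. by move=> /has_sup_quantile[_ H] zt; exact: ub_le_sup. Qed.

Lemma quantile_le t w : 0 < t < 1 -> t < F w -> quantile t <= w.
Proof.
move=> /has_sup_quantile[S0 _] tw; apply: ge_sup => // z /= zt.
rewrite leNgt; apply/negP => /ltW /(distr_fun_homo mu) wz.
by move: tw; rewrite ltNge (le_trans wz zt).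
Qed.

Lemma central01 n s j t : 0 <= s -> (j < n)%N -> central n s j t -> 0 < t < 1.
Proof.
move=> s0 jn /andP[jt tj].
have n0 : 0 < n%:R :> R by rewrite ltr0n (leq_ltn_trans _ jn).
have j0 : 0 <= j%:R :> R by [].
have jn' : j.+1%:R <= n%:R :> R by rewrite ler_nat.
apply/andP; split; first by rewrite -(pmulr_rgt0 _ n0); lra.
by rewrite -(ltr_pM2l n0) mulr1; lra.
Qed.

Lemma gap_bounded_spread n s j a b : 0 <= s -> (j < n)%N ->
  gap_bounded mu eps n s -> central n s j a -> central n s j b ->
  quantile b - quantile a <= 2 * s / (n%:R * eps).
Proof.
move=> s0 jn ns ca cb; set c := (X in _ <= X).
have n0 : 0 < n%:R :> R by rewrite ltr0n (leq_ltn_trans _ jn).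
have a01 := central01 s0 jn ca; have b01 := central01 s0 jn cb.
rewrite lerBlDl; apply: ge_sup; first by have [] := has_sup_quantile b01.
move=> z /= zb; rewrite -lerBlDr; apply/ler_addgt0Pr => e e0.
have aF : a < F (quantile a + e).
  rewrite ltNge; apply/negP => /(le_quantile a01); lra.
suff : z - (quantile a + e) <= c by lra.
apply: (ns j) => //.
  move: cb => /andP[_]; apply: le_lt_trans; by rewrite ler_pM2l.
by move: ca => /andP[+ _] => /lt_trans; apply; rewrite ltr_pM2l.
Qed.

(** Given z above w, choose levels a just below F w and b just above F z inside
    the window; then w and z lie between the quantiles of a and b. *)
Lemma spread_gap_bounded n s : 0 < s < 2^-1 ->
  (forall j a b, (j < n)%N -> central n s j a -> central n s j b -> a <= b ->
    quantile b - quantile a <= 2 * s / (n%:R * eps)) ->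
  gap_bounded mu eps n s.
Proof.
move=> /andP[s0 s2] H j z w jn zj jw.
have n0 : 0 < n%:R :> R by rewrite ltr0n (leq_ltn_trans _ jn).
have [wz|zw] := leP w z; last first.
  have : 0 <= 2 * s / (n%:R * eps) by rewrite divr_ge0// mulr_ge0// ltW.
  by lra.
have Fwz := distr_fun_homo mu wz.
have nFwz : n%:R * F w <= n%:R * F z by rewrite ler_pM2l.
pose a := (j%:R + s + n%:R * F w) / 2 / n%:R.
pose b := (j.+1%:R - s + n%:R * F z) / 2 / n%:R.
have na : n%:R * a = (j%:R + s + n%:R * F w) / 2 by rewrite mulrC divfK// gt_eqF.
have nb : n%:R * b = (j.+1%:R - s + n%:R * F z) / 2 by rewrite mulrC divfK// gt_eqF.
have ca : central n s j a by rewrite /central na; apply/andP; split; lra.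
have cb : central n s j b by rewrite /central nb; apply/andP; split; lra.
have a01 := central01 (ltW s0) jn ca; have b01 := central01 (ltW s0) jn cb.
have ab : a <= b by rewrite -(ler_pM2l n0) na nb; lra.
apply: le_trans (H j a b jn ca cb ab).
apply: lerB.
  by apply: le_quantile => //; rewrite -(ler_pM2l n0) nb; lra.
by apply: quantile_le => //; rewrite -(ltr_pM2l n0) na; lra.
Qed.

(** A point t of [a, b] lies in windows of parameter s' for arbitrarily large n.
    The windows of parameter s extend beyond them by (s' - s) / n, so the
    quantile varies by at most 2 s / (n eps) within the distance
    (s' - s) / (2 n) of t. Letting n grow shows that it is continuous at t, and
    a single n shows that it climbs from t with slope at most
    4 s / (eps (s' - s)) on some interval to the right; [real_induction]
    combines these two facts. *)
Lemma quantile_lipschitz s s' N a b : 0 <= s -> s < s' ->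
  (forall n, (N <= n)%N -> gap_bounded mu eps n s) ->
  0 < a -> a <= b -> b < 1 ->
  (forall t, a <= t <= b -> (s'%:E < Omega (iota_odd t))%E) ->
  quantile b - quantile a <= 4 * s / (eps * (s' - s)) * (b - a).
Proof.
move=> s0 ss' ns a0 ab b1 abs; set K := (X in _ <= X * _).
have ss0 : 0 < s' - s by rewrite subr_gt0.
have K0 : 0 <= K by rewrite divr_ge0// mulr_ge0// ltW.
have step t M : a <= t <= b -> exists2 n, (M < n)%N & forall u,
    n%:R * `|t - u| <= (s' - s) / 2 ->
    quantile u - quantile t <= 2 * s / (n%:R * eps) /\
    quantile t - quantile u <= 2 * s / (n%:R * eps).
  move=> tab; have t01 : 0 < t < 1.
    move/andP: tab => [at_ tb].
    by rewrite (lt_le_trans a0 at_) (le_lt_trans tb b1).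
  have s'0 : 0 <= s' by lra.
  have [n [j [Mn jn cj]]] :=
    central_infinitely_often s'0 t01 (abs t tab) (maxn N M.+1).
  have n0 : 0 < n%:R :> R by rewrite ltr0n (leq_ltn_trans _ jn).
  exists n; first by rewrite (leq_trans _ Mn)// leq_max leqnn orbT.
  move=> u; rewrite -[n%:R in X in X -> _]ger0_norm// -normrM mulrBr ler_norml.
  move=> /andP[ul ur].
  have cu : central n s j u.
    by move/andP: cj => [cl cr]; apply/andP; split; lra.
  have ct : central n s j t by apply: central_sub cj; exact: ltW.
  have nN : gap_bounded mu eps n s by apply: ns; exact: leq_trans (leq_maxl _ _) Mn.
  by split; apply: (@gap_bounded_spread n s j).
pose P t := quantile t - quantile a <= K * (t - a).
apply: (@real_induction _ P a b ab).
- by rewrite /P !subrr mulr0.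
- move=> t /andP[at_ tb] Pt; rewrite /P; apply/ler_addgt0Pr => e e0.
  have [|n nM nt] := step t (Num.trunc (2 * s / (eps * e))).
    by rewrite tb ltW.
  have n0 : 0 < n%:R :> R by rewrite ltr0n (leq_ltn_trans _ nM).
  have ne : 2 * s / (n%:R * eps) <= e.
    have : 2 * s / (eps * e) <= n%:R.
      by apply: (le_trans (ltW (truncnS_gt _))); rewrite ler_nat.
    by rewrite !ler_pdivrMr ?mulr_gt0//; lra.
  have [|v [tv /andP[av vt] Pv]] := Pt (t - (s' - s) / 2 / n%:R).
    by rewrite ltrBlDr ltrDl !divr_gt0.
  have [_ tv'] : quantile v - quantile t <= 2 * s / (n%:R * eps) /\
      quantile t - quantile v <= 2 * s / (n%:R * eps).
    apply: nt; rewrite ger0_norm; last by lra.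
    by rewrite mulrC -ler_pdivlMr//; lra.
  have : K * (v - a) <= K * (t - a) by rewrite ler_wpM2l//; lra.
  by move: Pv; rewrite /P; lra.
- move=> t /andP[at_ tb] Pt.
  have [|n nM nt] := step t (Num.trunc ((s' - s) / 2 / (b - t))).
    by rewrite at_ ltW.
  have n0 : 0 < n%:R :> R by rewrite ltr0n (leq_ltn_trans _ nM).
  have bt : 0 < b - t by rewrite subr_gt0.
  have d0 : 0 < (s' - s) / 2 / n%:R by rewrite !divr_gt0.
  have db : (s' - s) / 2 / n%:R <= b - t.
    rewrite ler_pdivrMr// [leRHS]mulrC -ler_pdivrMr//.
    by apply: (le_trans (ltW (truncnS_gt _))); rewrite ler_nat.
  exists (t + (s' - s) / 2 / n%:R); first by apply/andP; split; lra.
  set r := t + _.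
  have [tr _] : quantile r - quantile t <= 2 * s / (n%:R * eps) /\
      quantile t - quantile r <= 2 * s / (n%:R * eps).
    apply: nt; rewrite /r opprD addNKr normrN ger0_norm ?(ltW d0)//.
    by rewrite mulrC divfK// gt_eqF.
  have rK : 2 * s / (n%:R * eps) = K * (r - t).
    rewrite /K /r; field; rewrite !gt_eqF//; lra.
  by move: Pt tr; rewrite /P rK; lra.
Qed.

End Quantile.

(** * Null sets, growth sets and differentiation *)

Section MeasuresOnTheLine.
Context {R : realType}.
Implicit Types (rho : {measure set (measurableTypeR R) -> \bar R}) (a b : R).
Local Open Scope ereal_scope.
Local Notation leb := (@lebesgue_measure R).

(** Cover N by intervals ]a, b] of total length e / (K + 1); the part of each in
    ]l, r] has mass at most K (b - a). *)
Lemma lipschitz_null rho (K l r : R) (N : set (measurableTypeR R)) : (0 <= K)%R ->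
  (forall a b, (l <= a)%R -> (a <= b)%R -> (b <= r)%R ->
    rho `]a, b]%classic <= (K * (b - a))%:E) ->
  measurable N -> leb N = 0 -> rho (N `&` `]l, r]) = 0.
Proof.
move=> K0 rhoK mN N0.
apply/eqP; rewrite eq_le measure_ge0 andbT; apply/lee_addgt0Pr => e e0.
rewrite add0e.
have K1 : (0 < K + 1)%R by rewrite ltr_wpDl.
have e1 : (0 < e / (K + 1))%R by rewrite divr_gt0.
have infN : ereal_inf [set \sum_(k <oo) wlength idfun (A k) |
    A in @measurable_cover _ (ocitv_type R) N] = 0 by exact: N0.
have /(lb_ereal_inf_adherent e1)[_ [A [mA NA] <-] Ae] :
    ereal_inf [set \sum_(k <oo) wlength idfun (A k) |
      A in @measurable_cover _ (ocitv_type R) N] \is a fin_num by rewrite infN.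
rewrite infN add0e in Ae.
have piece k : rho (A k `&` `]l, r]) <= K%:E * wlength idfun (A k).
  have [->|[[a b]/= ab ->]] := (ocitvP _).1 (mA k).
    by rewrite set0I measure0 wlength0 mule0.
  rewrite (wlength_itv_bnd _ _ _ (ltW ab))/= -EFinM.
  have -> : `]a, b]%classic `&` `]l, r] = `]Num.max a l, Num.min b r]%classic.
    apply/seteqP; split => t /=; rewrite !in_itv/= gt_max le_min.
      by move=> [/andP[-> ->] /andP[-> ->]].
    by move=> /andP[/andP[-> ->] /andP[-> ->]].
  have [mm|mm] := leP (Num.max a l) (Num.min b r).
    have lm : (l <= Num.max a l)%R by rewrite le_max lexx orbT.
    have mr : (Num.min b r <= r)%R by rewrite ge_min lexx orbT.
    have H := rhoK _ _ lm mm mr.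
    apply: (le_trans H).
    by rewrite lee_fin ler_wpM2l// lerB// ?ge_min ?le_max ?lexx.
  rewrite set_itv_ge ?measure0 ?lee_fin ?mulr_ge0 ?subr_ge0 ?(ltW ab)//.
  by rewrite bnd_simp -leNgt ltW.
have mAk k : measurable (A k `&` `]l, r]%classic : set (measurableTypeR R)).
  apply: measurableI => //.
  have [->//|[[a b]/= ab ->//]] := (ocitvP _).1 (mA k).
have NAr : N `&` `]l, r] `<=` \bigcup_k (A k `&` `]l, r]%classic).
  by move=> t [/NA[k _ kt] tlr]; exists k.
have := measure_sigma_subadditive rho mAk _ NAr.
move=> /(_ (measurableI _ _ mN (measurable_itv _)))/le_trans; apply.
apply: (@le_trans _ _ (\sum_(k <oo) K%:E * wlength idfun (A k))).
  by apply: lee_nneseries => // k _; exact: measure_ge0.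
rewrite nneseriesZl//.
apply: (@le_trans _ _ (K%:E * (e / (K + 1))%:E)).
  by rewrite lee_wpmul2l ?lee_fin// ltW.
rewrite -EFinM lee_fin mulrCA ler_piMr ?ltW//.
by rewrite ltr_pdivrMr// mul1r ltrDl.
Qed.

End MeasuresOnTheLine.

Section NoGrowth.
Context {R : realType} (rho : {measure set (measurableTypeR R) -> \bar R}) (g : R -> \bar R).
Hypothesis gP : growth_function rho g.
Implicit Types (a b t : R).
Local Open Scope ereal_scope.

(** The function is constant around every point that is not a growth point;
    [real_induction] carries its value at a over to b. *)
Lemma no_growth_null a b : (0 < a)%R -> (a <= b)%R -> (b < 1)%R ->
  (forall t, (a <= t <= b)%R -> ~ growth_set g t) -> rho `]a, b]%classic = 0.
Proof.
case: gP => ghomo _ _ gfin grho a0 ab b1 nog.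
have gloc t : (a <= t <= b)%R -> exists2 e, (0 < e)%R &
    forall u, (t - e <= u <= t + e)%R -> g u = g t.
  move=> /nog /existsNP[e /not_implyP[e0 /negP]]; rewrite -leNgt => ge.
  exists e => //; have H u : (t - e <= u <= t + e)%R -> g u = g (t - e)%R.
    move=> /andP[ul ur]; apply/eqP; rewrite eq_le (le_trans (ghomo _ _ ur) ge).
    exact: ghomo.
  move=> u ut; rewrite (H u ut) -(H t)//; apply/andP; split; lra.
have : g b = g a.
  apply: (@real_induction _ (fun t => g t = g a) a b ab) => //.
  - move=> t /andP[at_ tb] Pt.
    have [|e e0 et] := gloc t; first by rewrite tb ltW.
    have [|v [tv /andP[_ vt] <-]] := Pt (t - e)%R; first by rewrite ltrBlDr ltrDl.
    by rewrite (et v)//; apply/andP; split; lra.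
  - move=> t /andP[at_ tb] Pt.
    have [|e e0 et] := gloc t; first by rewrite at_ ltW.
    exists (Num.min b (t + e)%R).
      by rewrite lt_min tb ge_min lexx ltrDl e0.
    rewrite -Pt; apply: et; rewrite le_min ge_min lexx orbT andbT.
    by apply/andP; split; lra.
move=> gba; rewrite grho// gba subee// gfin//; exact: le_lt_trans ab b1.
Qed.

Lemma growth_set_itv t : growth_set g t -> (0 <= t <= 1)%R.
Proof.
case: gP => ghomo _ [gN gy] _ _ gt; apply/andP; split.
  rewrite leNgt; apply/negP => t0.
  have t2 : (0 < - t / 2)%R by lra.
  by have := gt _ t2; rewrite !gN ?ltxx//; lra.
rewrite leNgt; apply/negP => t1.
have t2 : (0 < (t - 1) / 2)%R by lra.
by have := gt _ t2; rewrite !gy ?ltxx//; lra.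
Qed.

Lemma growth_set_gt0 t e : growth_set g t -> (0 < e)%R ->
  (0 < t - e)%R -> (t + e < 1)%R -> 0 < rho `](t - e)%R, (t + e)%R]%classic.
Proof.
case: gP => _ _ _ gfin grho gt e0 te0 te1; rewrite grho//; last by lra.
by rewrite sube_gt0 ?gt// gfin//; lra.
Qed.

End NoGrowth.

Section OmegaBounds.
Context {R : realType}.
Implicit Types (u : \bar R) (s eps : R).
Local Open Scope ereal_scope.

Lemma Omega_ge0 u : 0 <= u -> 0 <= Omega u.
Proof.
case: u => [r| |] u0; rewrite /Omega ?lee_fin ?invr_ge0//.
by rewrite divr_ge0// addr_ge0// mulr_ge0.
Qed.

Lemma Omega_le_half u : Omega u <= (2^-1)%:E.
Proof.
case: u => [r| |]//=; rewrite lee_fin; last by lra.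
have r0 := normr_ge0 r; rewrite ler_pdivrMr; last by lra.
by have := ler_norm r; lra.
Qed.

Lemma Omega_leE u s : 0 <= u -> (s < 2^-1)%R ->
  (Omega u <= s%:E) = (u <= (2 * s / (1 - 2 * s))%:E).
Proof.
move=> u0 s2; have s0 : (0 < 1 - 2 * s)%R by lra.
case: u u0 => [r| |]//=; rewrite ?lee_fin => r0.
  rewrite ger0_norm// ler_pdivrMr ?ler_pdivlMr//; last by lra.
  by apply/idP/idP; lra.
by rewrite leye_eq/=; apply/negbTE; rewrite -ltNge.
Qed.

Lemma Omega_scale_leE u s eps : (0 < eps)%R -> 0 <= u -> (s < 2^-1)%R ->
  (Omega (eps%:E * u) <= s%:E) = (u <= (2 * s / (1 - 2 * s) / eps)%:E).
Proof.
move=> eps0 u0 s2; rewrite Omega_leE ?mule_ge0 ?lee_fin ?(ltW eps0)//.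
by rewrite [in RHS]EFinM lee_pdivlMr// muleC.
Qed.

End OmegaBounds.

Section Differentiation.
Context {R : realType}.
Local Open Scope ereal_scope.
Local Notation leb := (@lebesgue_measure R).

Lemma nicely_shrinking_ball (y : R) : nicely_shrinking y (fun k => ball y k.+1%:R^-1).
Proof.
split=> [k|]; first exact: measurable_ball.
have r0 k : (0 < k.+1%:R^-1 :> R)%R by rewrite invr_gt0.
exists (1%R, fun k => PosNum (r0 k)); split => //=.
- exact: cvg_harmonic.
- by move=> k; exact: subset_refl.
- by move=> k; rewrite mul1e.
Qed.

Lemma lebesgue_pt_le (g : R -> R) (t C : R) (E : (set R)^nat) :
  locally_integrable setT g -> lebesgue_pt g t -> nicely_shrinking t E ->
  (forall k, \int[leb]_(y in E k) (g y)%:E <= C%:E * leb (E k)) -> (g t <= C)%R.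
Proof.
move=> lg gt tE EC.
(* The differentiation theorem asks for a family shrinking nicely to every
   point; balls serve at the points other than t. *)
pose E' (y : R) : (set R)^nat := if y == t then E else fun k => ball y k.+1%:R^-1.
have hE' y : nicely_shrinking y (E' y).
  by rewrite /E'; case: eqP => [->//|_]; exact: nicely_shrinking_ball.
have := nice_lebesgue_differentiation hE' lg gt.
rewrite /E' eqxx => gE.
rewrite -lee_fin -(cvg_lim (@ereal_hausdorff R) gE); apply: lime_le.
  by apply/cvg_ex; exists (g t)%:E.
apply: nearW => k.
have Ek0 := nicely_shrinking_gt0 tE k.
have Ekf := nicely_shrinking_fin_num tE k.
apply: (@le_trans _ _ ((leb (E k))^-1 * (C%:E * leb (E k)))).
  by apply: lee_wpmul2l => //; rewrite inve_ge0.
by rewrite muleCA mulVe ?mule1// gt_eqF.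
Qed.

End Differentiation.

(** * Decomposition of the inverse measure *)

Section InverseMeasureDecomposition.
Context {R : realType} (mu : probability (measurableTypeR R) R) (eps : R).
Hypothesis eps_gt0 : 0 < eps.
Context (rho rhoA rhoS : {measure set (measurableTypeR R) -> \bar R})
  (f gS : R -> \bar R).
Hypotheses (rhoP : inverse_measure mu rho)
  (rhoAS : lebesgue_decomposition rho rhoA rhoS)
  (fP : lebesgue_RN_density rhoA f) (gSP : growth_function rhoS gS).
Implicit Types (a b s t : R) (n j : nat).
Local Open Scope ereal_scope.
Local Notation leb := (@lebesgue_measure R).
Local Notation q := (quantile mu).

Lemma inverse_measure_itv a b : (0 < a)%R -> (a <= b)%R -> (b < 1)%R ->
  rho `]a, b]%classic = (q b - q a)%:E.
Proof.
case: rhoP => _ _ rhoE a0 ab b1; rewrite rhoE// !distr_inv_quantile//.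
  by rewrite a0 (le_lt_trans ab b1).
by rewrite b1 (lt_le_trans a0 ab).
Qed.

Lemma density_integral_le a b (C : R) : (a <= b)%R -> (0 <= C)%R ->
  {ae leb, forall t, f t <= C%:E} -> rhoA `]a, b]%classic <= (C * (b - a))%:E.
Proof.
case: fP => mf f0 fE ab C0 fC; rewrite fE//.
apply: (@le_trans _ _ (\int[leb]_(t in `]a, b]%classic) C%:E)).
  apply: ae_ge0_le_integral => //.
  - exact: measurable_funTS.
  - by apply: (@filterS _ _ (ae_filter_ringOfSetsType leb)) fC => t ft _.
rewrite integral_cst//= lebesgue_measure_itv/= lte_fin.
by case: ltP => // ba; rewrite mule0 lee_fin mulr_ge0// subr_ge0.
Qed.

(** On a window the singular part vanishes, and the density is at most
    2 s / (1 - 2 s) / eps; the length (1 - 2 s) / n of the window cancels the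
    denominator. *)
Lemma omega_bounds_gap_bounded n s : (0 < s < 2^-1)%R ->
  {ae leb, forall t, Omega (eps%:E * f t) <= s%:E} ->
  (forall t, growth_set gS t -> Omega (iota_odd t) <= s%:E) ->
  gap_bounded mu eps n s.
Proof.
move=> s02 fs gs; apply: spread_gap_bounded => // j a b jn ca cb ab.
have /andP[s0 s2] := s02.
have n0 : (0 < n%:R :> R)%R by rewrite ltr0n (leq_ltn_trans _ jn).
have /andP[a0 a1] := central01 (ltW s0) jn ca.
have /andP[b0 b1] := central01 (ltW s0) jn cb.
have [rhoAS_ _ _] := rhoAS; have [mf f0 fE] := fP.
rewrite -lee_fin -inverse_measure_itv// rhoAS_//.
rewrite [X in _ + X](no_growth_null gSP)// ?adde0; last first.
  move=> t /andP[at_ tb] /gs; apply/negP; rewrite -ltNge.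
  apply: (central_lt_iota (n := n) (j := j)) => //.
  move: ca cb => /andP[al ar] /andP[bl br].
  have nat_ : (n%:R * a <= n%:R * t)%R by rewrite ler_pM2l.
  have ntb : (n%:R * t <= n%:R * b)%R by rewrite ler_pM2l.
  by apply/andP; split; lra.
pose C := (2 * s / (1 - 2 * s) / eps)%R.
have s20 : (0 < 1 - 2 * s)%R by lra.
have C0 : (0 <= C)%R by rewrite !divr_ge0 ?mulr_ge0// ltW.
have fC : {ae leb, forall t, f t <= C%:E}.
  by apply: (@filterS _ _ (ae_filter_ringOfSetsType leb)) fs => t; rewrite Omega_scale_leE.
apply: (le_trans (density_integral_le ab C0 fC)); rewrite lee_fin.
have -> : (2 * s / (n%:R * eps) = C * ((1 - 2 * s) / n%:R))%R.
  by rewrite /C; field; rewrite !gt_eqF.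
rewrite ler_wpM2l// ler_pdivlMr// mulrBl.
move: ca cb => /andP[al _] /andP[_]; rewrite -natr1; lra.
Qed.

Section EventuallyGapBounded.
Variables (N : nat) (s s' : R).
Hypotheses (s_ge0 : (0 <= s)%R) (ss' : (s < s')%R)
  (Ns : forall n, (N <= n)%N -> gap_bounded mu eps n s).

(** If s' < Omega (iota t), then t lies in a window of parameter s', all of whose
    points have the same property. The inverse measure is Lipschitz there, hence
    vanishes on the Lebesgue-null set carrying the singular part, although this
    part charges every neighbourhood of a growth point. *)
Lemma eventually_growth_le t : growth_set gS t -> Omega (iota_odd t) <= s'%:E.
Proof.
move=> gt; rewrite leNgt; apply/negP => s't.
have s'0 : (0 < s')%R by apply: le_lt_trans ss'.
have t01 : (0 < t < 1)%R.
  have [_ H] := (lt_Omega_iotaP _ _).1 s't.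
  have nint : t \isn't a Num.int.
    by apply/negP => ti; have := H 0%N; rewrite mul1r => /(_ ti); lra.
  have /andP[t0 t1] := growth_set_itv gSP gt.
  rewrite !lt_neqAle t0 t1 !andbT; apply/andP; split; apply/eqP => tE.
    by rewrite -tE rpred0 in nint.
  by rewrite tE rpred1 in nint.
have [n [j [_ jn ct]]] := central_infinitely_often (ltW s'0) t01 s't 0.
have n0 : (0 < n%:R :> R)%R by rewrite ltr0n (leq_ltn_trans _ jn).
have /andP[tl tr] := ct.
pose d := Num.min (n%:R * t - j%:R - s')%R (j.+1%:R - s' - n%:R * t)%R.
have d0 : (0 < d)%R by rewrite lt_min; apply/andP; split; lra.
have dl : (d <= n%:R * t - j%:R - s')%R by rewrite ge_min lexx.
have dr : (d <= j.+1%:R - s' - n%:R * t)%R by rewrite ge_min lexx orbT.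
pose e := (d / 2 / n%:R)%R.
have e0 : (0 < e)%R by rewrite !divr_gt0.
have ne : (n%:R * e = d / 2)%R by rewrite mulrC divfK// gt_eqF.
have cent u : (t - e <= u <= t + e)%R -> central n s' j u.
  move=> /andP[ul ur].
  have nul : (n%:R * (t - e) <= n%:R * u)%R by rewrite ler_pM2l.
  have nur : (n%:R * u <= n%:R * (t + e))%R by rewrite ler_pM2l.
  by move: nul nur; rewrite mulrBr mulrDr ne => nul nur; apply/andP; split; lra.
have c01 u : (t - e <= u <= t + e)%R -> (0 < u < 1)%R.
  by move=> /cent; exact: central01 (ltW s'0) jn.
have /andP[te0 _] : (0 < t - e < 1)%R by apply: c01; rewrite lexx; lra.
have /andP[_ te1] : (0 < t + e < 1)%R by apply: c01; rewrite lexx; lra.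
have [rhoAS_ _ [Z [mZ Z0 SZ]]] := rhoAS.
have ss0 : (0 < s' - s)%R by rewrite subr_gt0.
have K0 : (0 <= 4 * s / (eps * (s' - s)))%R by rewrite divr_ge0// mulr_ge0// ltW.
have rhoZ : rho (Z `&` `](t - e)%R, (t + e)%R]) = 0.
  apply: (lipschitz_null K0) => // a b ta ab bt.
  have a0 : (0 < a)%R by lra.
  have b1 : (b < 1)%R by lra.
  rewrite inverse_measure_itv// lee_fin.
  apply: (quantile_lipschitz eps_gt0 s_ge0 ss' Ns) => // u /andP[au ub].
  by apply: (central_lt_iota s'0 (n := n) (j := j)); apply: cent; apply/andP; split; lra.
have := growth_set_gt0 gSP gt e0 te0 te1; apply/negP; rewrite -leNgt.
set I := `]_, _]%classic.
have mI : measurable (I : set (measurableTypeR R)) by exact: measurable_itv.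
have mZC : measurable (~` Z : set (measurableTypeR R)) by exact: measurableC.
have mIZ : measurable (Z `&` I : set (measurableTypeR R)) by exact: measurableI.
have -> : 0 = rhoS (Z `&` I) + rhoS (~` Z).
  rewrite SZ adde0; apply/esym/eqP; rewrite eq_le measure_ge0 andbT -rhoZ rhoAS_//.
  by rewrite leeDr// measure_ge0.
apply: (le_trans _ (measureU2 _ mIZ mZC)).
apply: le_measure; rewrite ?inE//; first exact: measurableU.
by move=> u Iu; have [|] := pselect (Z u); [left|right].
Qed.

Hypothesis s'2 : (s' < 2^-1)%R.

Let s'0 : (0 < s')%R. Proof. exact: le_lt_trans ss'. Qed.

Let rhoA_le_rho A : measurable A -> rhoA A <= rho A.
Proof. by case: rhoAS => rhoE _ _ mA; rewrite rhoE// leeDl// measure_ge0. Qed.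

(** The windows of parameter s' containing t have length (1 - 2 s') / n, hence
    shrink nicely to t as n grows. They lie inside windows of parameter s, so
    their mass is at most 2 s / (n eps), and the mean of g over them at most
    2 s' / (1 - 2 s') / eps. *)
Lemma density_le_at_lebesgue_pt (g : R -> R) t : locally_integrable setT g ->
  (forall y, (0 <= g y)%R) -> (forall y, (g y)%:E <= f y) -> lebesgue_pt g t ->
  (0 < t < 1)%R -> s'%:E < Omega (iota_odd t) ->
  (g t <= 2 * s' / (1 - 2 * s') / eps)%R.
Proof.
move=> lg g0 gf gt t01 s't.
have [mf f0 fE] := fP.
have s'20 : (0 < 1 - 2 * s')%R by have := s'2; lra.
have /choice[nj njP] : forall k, exists nj : nat * nat, [/\ (maxn N k.+1 <= nj.1)%N,
    (nj.2 < nj.1)%N & central nj.1 s' nj.2 t].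
  move=> k; have [n [j njP]] := central_infinitely_often (ltW s'0) t01 s't (maxn N k.+1).
  by exists (n, j).
pose n k := (nj k).1; pose j k := (nj k).2.
have n0 k : (0 < (n k)%:R :> R)%R.
  by rewrite ltr0n; have [_ + _] := njP k; apply: leq_ltn_trans.
pose l k := ((j k)%:R + s')%R; pose r k := ((j k).+1%:R - s')%R.
have rl k : (r k - l k = 1 - 2 * s')%R by rewrite /r /l -natr1; lra.
pose E k := `](l k / (n k)%:R)%R, (r k / (n k)%:R)%R]%classic.
have lr k : (l k / (n k)%:R < r k / (n k)%:R)%R.
  by rewrite ltr_pM2r ?invr_gt0//; have := rl k; lra.
have EV k : leb (E k) = ((1 - 2 * s') / (n k)%:R)%:E.
  by rewrite lebesgue_measure_itv/= lte_fin lr -EFinB -mulrBl rl.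
have rad k : (0 < (n k)%:R^-1 :> R)%R by rewrite invr_gt0.
have Et : nicely_shrinking t E.
  split=> [k|]; first exact: measurable_itv.
  exists ((2 / (1 - 2 * s'))%R, fun k => PosNum (rad k)); split => /=.
  - by rewrite divr_gt0.
  - apply: (@squeeze_cvgr _ _ _ _ (fun=> 0%R) harmonic).
    + apply: nearW => k; rewrite /= (ltW (rad k))/= lef_pV2 ?posrE// ler_nat.
      by have [+ _ _] := njP k; rewrite geq_max => /andP[].
    + exact: cvg_cst.
    + exact: cvg_harmonic.
  - move=> k y; rewrite /E/= in_itv/= => /andP[].
    rewrite ltr_pdivrMr// ler_pdivlMr// => ly yr.
    have [_ _ /andP[]] := njP k; rewrite -/(n k) -/(j k) -/(l k) -/(r k) => lt tr.
    rewrite /ball/= -(ltr_pM2l (n0 k)) mulfV ?gt_eqF//.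
    rewrite -[X in (X * _)%R]ger0_norm ?(ltW (n0 k))// -normrM mulrBr ltr_norml.
    have := rl k; move: ly yr; rewrite ![(y * _)%R]mulrC => ly yr rlk.
    by have := s'0 => ?; apply/andP; split; lra.
  - move=> k; rewrite lebesgue_measure_ball ?(ltW (rad k))// EV -EFinM lee_fin.
    by rewrite mulrA divfK ?gt_eqF// mulr2n mulrDl mul1r.
apply: (lebesgue_pt_le lg gt Et) => k; rewrite EV -EFinM.
apply: (@le_trans _ _ (rhoA (E k))).
  rewrite fE; last exact: measurable_itv.
  apply: ge0_le_integral => //.
  - exact: measurable_itv.
  - by move=> y _; rewrite lee_fin.
  - apply/measurable_EFinP; apply: measurable_funTS; by case: lg.
  - exact: measurable_funTS.
apply: (le_trans (rhoA_le_rho (measurable_itv _))).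
have [Nk jn _] := njP k.
have cent u : (l k <= (n k)%:R * u <= r k)%R -> central (n k) s (j k) u.
  by have := ss'; rewrite /l /r => ? /andP[? ?]; apply/andP; split; lra.
have nl : ((n k)%:R * (l k / (n k)%:R) = l k)%R by rewrite mulrC divfK// gt_eqF.
have nr : ((n k)%:R * (r k / (n k)%:R) = r k)%R by rewrite mulrC divfK// gt_eqF.
have cl : central (n k) s (j k) (l k / (n k)%:R).
  by apply: cent; rewrite nl lexx; have := rl k; lra.
have cr : central (n k) s (j k) (r k / (n k)%:R).
  by apply: cent; rewrite nr lexx andbT; have := rl k; lra.
have /andP[l0 _] := central01 s_ge0 jn cl.
have /andP[_ r1] := central01 s_ge0 jn cr.
rewrite inverse_measure_itv ?(ltW (lr k))// lee_fin.
have gk : gap_bounded mu eps (n k) s.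
  by apply: Ns; apply: leq_trans Nk; rewrite leq_maxl.
apply: (le_trans (gap_bounded_spread s_ge0 jn gk cl cr)).
have -> : (2 * s' / (1 - 2 * s') / eps * ((1 - 2 * s') / (n k)%:R) =
    2 * s' / ((n k)%:R * eps))%R.
  by field; rewrite !gt_eqF// n0.
have ne0 : (0 < ((n k)%:R * eps)^-1)%R by rewrite invr_gt0 mulr_gt0.
by rewrite ler_pM2r// ler_wpM2l// ltW.
Qed.

(* The density need not be integrable on ]0, 1[, as the inverse measure may have
   infinite mass near 0 and 1; it is integrable on each of the intervals D m,
   which exhaust ]0, 1[. *)
Let D m := `](m.+2%:R^-1 : R)%R, (1 - m.+2%:R^-1 : R)%R]%classic.

Let Dfin m : rhoA (D m) < +oo.
Proof.
apply: (le_lt_trans (rhoA_le_rho (measurable_itv _))).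
have m2 : (m.+2%:R^-1 <= 2^-1 :> R)%R by rewrite lef_pV2 ?posrE ?ltr0n// ler_nat.
have m0 : (0 < m.+2%:R^-1 :> R)%R by rewrite invr_gt0.
move: (m.+2%:R^-1 : R)%R m2 m0 => e e2 e0.
by rewrite inverse_measure_itv ?ltry//; lra.
Qed.

Let f_integrable m : leb.-integrable (D m) f.
Proof.
have [mf f0 fE] := fP; apply/integrableP; split; first exact: measurable_funTS.
under eq_integral do rewrite gee0_abs//.
by rewrite -fE; [exact: Dfin|exact: measurable_itv].
Qed.

Let g m : R -> R := (fine \o f) \_ (D m).

Let g_integrable m : locally_integrable setT (g m).
Proof.
have [mf f0 fE] := fP.
apply: integrable_locally_restrict; first exact: measurable_itv.
apply: le_integrable (f_integrable m) => //; first exact: measurable_itv.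
  apply: measurable_funTS; apply/measurable_EFinP.
  exact: measurableT_comp.
move=> t _ /=; have := f0 t; case: (f t) => [r| |]//= _.
by rewrite normr0 leey.
Qed.

(* Only rational points fail the condition, as s' < 1/2. *)
Let irrational_ae : {ae leb, forall t : R, s'%:E < Omega (iota_odd t)}.
Proof.
exists (range (@ratr R)); split.
- apply: countable_measurable => [t|]; first exact: measurable_set1.
  exact: sub_countable (card_image_le _ _) (countableP _).
- exact: lebesgue_measure_rat.
move=> t /=; apply: contra_notP => nt.
apply/lt_Omega_iotaP; split=> // k /intrP[p kp]; exfalso; apply: nt.
have k0 : ((2 * k + 1)%:R != 0 :> R)%R by rewrite pnatr_eq0 addn1.
exists (p%:~R / (2 * k + 1)%:R)%R => //.
by rewrite fmorph_div/= rmorph_int rmorph_nat -kp mulrC mulKf.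
Qed.

Let f_out_ae : {ae leb, forall t : R, (~` `]0%R, 1%R[) t -> f t = 0}.
Proof.
have [mf f0 fE] := fP; have [_ rho0 _] := rhoP.
have mD : measurable (~` `]0%R, 1%R[ : set (measurableTypeR R)).
  exact: measurableC.
apply/(ae_eq_integral_abs _ mD); first exact: measurable_funTS.
under eq_integral do rewrite gee0_abs//.
rewrite -fE//; apply/eqP; rewrite eq_le measure_ge0 andbT -rho0.
exact: rhoA_le_rho.
Qed.

Lemma eventually_density_le : {ae leb, forall t, Omega (eps%:E * f t) <= s'%:E}.
Proof.
have [mf f0 fE] := fP.
pose F := ae_filter_ringOfSetsType leb.
have lpt := ae_foralln (fun m => lebesgue_differentiation (g_integrable m)).
have mD m : measurable (D m : set (measurableTypeR R)) by exact: measurable_itv.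
have fin := ae_foralln (fun m => integrable_ae (mD m) (f_integrable m)).
have all := @filterI _ _ F _ _ lpt (@filterI _ _ F _ _ fin
  (@filterI _ _ F _ _ irrational_ae f_out_ae)).
apply: (@filterS _ _ F) all => t [tpt [tfin [tirr tout]]].
rewrite Omega_scale_leE//.
have C0 : (0 <= 2 * s' / (1 - 2 * s') / eps)%R.
  have := s'2; have := s'0 => s0 s2.
  by rewrite !divr_ge0 ?mulr_ge0 ?(ltW eps_gt0) ?(ltW s0)// subr_ge0; lra.
have [t01|nt01] := boolP (0 < t < 1)%R; last first.
  by rewrite tout ?lee_fin//= in_itv/=; exact/negP.
have [m Dt] : exists m, D m t.
  have /andP[t0 t1] := t01.
  pose d := Num.min t (1 - t)%R.
  have d0 : (0 < d)%R by rewrite lt_min t0 subr_gt0.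
  pose m := Num.trunc d^-1; exists m.
  have md : (m.+2%:R^-1 < d)%R.
    rewrite invf_plt ?posrE ?ltr0n//.
    by apply: (lt_trans (truncnS_gt _)); rewrite ltr_nat.
  rewrite /D/= in_itv/=; move: md; rewrite lt_min => /andP[-> md]/=.
  by move: (m.+2%:R^-1 : R)%R md => e; lra.
have gf y : (g m y)%:E <= f y.
  rewrite /g patchE; case: ifPn => _; last exact: f0.
  by rewrite /=; case: (f y) (f0 y) => [r _|_|]; rewrite ?leey.
have g0 y : (0 <= g m y)%R.
  by rewrite /g patchE; case: ifPn => // _; apply: fine_ge0.
have := density_le_at_lebesgue_pt (g_integrable m) g0 gf (tpt m) t01 tirr.
by rewrite -lee_fin /g patchE mem_set// /= fineK//; exact: tfin Dt.
Qed.

End EventuallyGapBounded.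

End InverseMeasureDecomposition.

(** * The asymptotic constant *)

Lemma levy_dist_ge0 (R : realType) (eps : R)
  (mu nu : {measure set (measurableTypeR R) -> \bar R}) : 0 <= levy_dist eps mu nu.
Proof.
rewrite /levy_dist; set S := [set y | _].
have [S0|/set0P/negP/negPn/eqP ->] := pselect (S !=set0); last by rewrite inf0.
by apply: lb_le_inf => // y [/ltW].
Qed.

Theorem theorem3p5 (R : realType)
    (mu : probability (measurableTypeR R) R) (eps : R) (eps_gt0 : 0 < eps)
    (x : forall n : nat, n.-tuple R)
    (x_best : forall n : nat, (0 < n)%N -> best_unif_approx eps mu (x n))
    (mu_inv mu_invA mu_invS : {measure set (measurableTypeR R) -> \bar R})
    (mu_invP : inverse_measure mu mu_inv)
    (mu_invAS : lebesgue_decomposition mu_inv mu_invA mu_invS)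
    (f : R -> \bar R) (fP : lebesgue_RN_density mu_invA f)
    (gS : R -> \bar R) (gSP : growth_function mu_invS gS) :
  limn_esup (fun n : nat =>
      (n%:R * levy_dist eps mu (delta_unif (x n)))%:E) =
  maxe (Lnorm lebesgue_measure +oo (fun t => Omega (eps%:E * f t)%E))
       (ereal_sup [set Omega (iota_odd s) | s in growth_set gS]).
Proof.
have [mf f0 fE] := fP.
set leb := (@lebesgue_measure R).
set u := (fun n : nat => (n%:R * levy_dist eps mu (delta_unif (x n)))%:E).
have u0 n : (0 <= u n)%E by rewrite lee_fin mulr_ge0// levy_dist_ge0.
set A := Lnorm _ _ _; set B := ereal_sup _.
have Of0 t : (0 <= Omega (eps%:E * f t))%E.
  by rewrite Omega_ge0// mule_ge0// lee_fin ltW.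
have lebT : (0 < leb setT)%E by rewrite /leb -set_itvNyy lebesgue_measure_itv/= ltry.
have AE : A = ess_sup leb (fun t => Omega (eps%:E * f t)%E).
  rewrite /A unlock /= -/leb lebT; congr (ess_sup _ _); apply/funext => t /=.
  by rewrite gee0_abs.
have ABr (s : R) : (maxe A B <= s%:E)%E <->
    {ae leb, forall t, (Omega (eps%:E * f t) <= s%:E)%E} /\
    (forall t, growth_set gS t -> (Omega (iota_odd t) <= s%:E)%E).
  rewrite ge_max AE; split=> [/andP[/ess_supP As Bs]|[As Bs]].
    split=> // t gt; apply: le_trans Bs; apply: ereal_sup_ubound; by exists t.
  apply/andP; split; first exact/ess_supP.
  by apply: ge_ereal_sup => _ [t gt <-]; exact: Bs.
have M2 : (maxe A B <= (2^-1)%:E)%E.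
  apply/ABr; split=> [|t _]; last exact: Omega_le_half.
  by apply: (@aeW _ _ _ leb) => t; exact: Omega_le_half.
have M0 : (0 <= maxe A B)%E.
  rewrite le_max AE ess_sup_gee//.
  by apply: (@aeW _ _ _ leb).
move: M0 M2 ABr; case: (maxe A B) => [m| |]//; rewrite !lee_fin => m0 m2 ABr.
apply/eqP; rewrite eq_le; apply/andP; split.
  rewrite limn_esup_lim (cvg_lim _ (@cvg_esups_inf R u))//.
  apply: (@le_trans _ _ (esups u 1)); first by apply: ereal_inf_lbound; exists 1%N.
  apply: ge_ereal_sup => _ [n /= n1 <-].
  rewrite lee_fin; apply/ler_addgt0Pr => e e0.
  apply: gap_bounded_levy_dist => //; [by rewrite ltr_wpDl|exact: x_best|].
  have [me|me] := ltP (m + e) 2^-1; last first.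
    by apply: (gap_bounded_le eps_gt0 me); exact: gap_bounded_half.
  have [fe ge] : {ae leb, forall t, (Omega (eps%:E * f t) <= (m + e)%:E)%E} /\
    (forall t, growth_set gS t -> (Omega (iota_odd t) <= (m + e)%:E)%E).
    by apply/ABr; rewrite lee_fin lerDl ltW.
  apply: (omega_bounds_gap_bounded eps_gt0 mu_invP mu_invAS fP gSP) => //.
  by rewrite me ltr_wpDl.
rewrite leNgt; apply/negP => um.
have [_ [N _ <-] uN] : exists2 y, range (esups u) y & (y < m%:E)%E.
  apply/ereal_inf_lt; move: um.
  by rewrite limn_esup_lim (cvg_lim _ (@cvg_esups_inf R u)).
have eN0 : (0 <= esups u N)%E.
  by apply: (le_trans (u0 N)); apply: ereal_sup_ubound; exists N => /=.
have [e eE] : exists e, esups u N = e%:E.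
  by exists (fine (esups u N)); rewrite fineK// ge0_fin_numE// (lt_trans uN)// ltry.
rewrite eE !lte_fin !lee_fin in uN eN0.
pose s := e + (m - e) / 3; pose s' := e + 2 * (m - e) / 3.
have Ns n : (maxn N 1 <= n)%N -> gap_bounded mu eps n s.
  rewrite geq_max => /andP[Nn n0].
  apply: (levy_dist_gap_bounded eps_gt0 n0 (x_best n n0)).
  apply: (@le_lt_trans _ _ e); last by rewrite /s; lra.
  by rewrite -lee_fin -eE; apply: ereal_sup_ubound; exists n.
have s0 : 0 <= s by rewrite /s; lra.
have ss' : s < s' by rewrite /s /s'; lra.
have s'2 : s' < 2^-1 by rewrite /s'; lra.
have : (m%:E <= s'%:E)%E.
  apply/ABr; split.
    exact: (eventually_density_le eps_gt0 mu_invP mu_invAS fP s0 ss' Ns s'2).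
  by move=> t; exact: (eventually_growth_le eps_gt0 mu_invP mu_invAS gSP s0 ss' Ns).
by rewrite lee_fin /s'; lra.
Qed.
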